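(* For every Steiner triple system $S$ on $n$ vertices, $\mathrm{mc}_3(S)\geq n-2\alpha^*_3(S)$.
   Context: A Steiner triple system is a $3$-uniform hypergraph in which each pair of distinct vertices is contained in exactly one edge. The shadow-graph $H^{(2)}$ of a hypergraph $H$ is the graph on $V(H)$ in which $\{x,y\}$ is an edge if and only if some $e\in E(H)$ satisfies $\{x,y\}\subseteq e$. $H$ is connected if $H^{(2)}$ is connected, and the components of $H$ are its maximal connected subgraphs (so an isolated vertex is a component on one vertex). An $r$-coloring of $H$ is a partition $\{E_1,\dots,E_r\}$ of $E(H)$ in which some of the sets may be empty. A monochromatic component of $H$ (with respect to this coloring) is a component of the hypergraph $(V(H),E_i)$ for some $i\in\{1,\dots,r\}$. $\mathrm{mc}_r(H)$ is the largest integer $m$ such that in every $r$-coloring of the edges of $H$ there is a monochromatic component on at least $m$ vertices. $\alpha_3^*(H)$ is the maximum integer $a$ such that there exist pairwise disjoint sets $X_1,X_2,X_3\subseteq V(H)$ with $|X_1|=|X_2|=|X_3|=a$ such that for every $e\in E(H)$ there is $i\in\{1,2,3\}$ with $e\cap X_i=\emptyset$. *)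

(* Defs.v *)
From mathcomp Require Import all_boot.

Set Implicit Arguments.
Unset Strict Implicit.
Unset Printing Implicit Defensive.

(* A hypergraph is a pair (vertex set, edge set) over an ambient finite type;
   the vertex set is kept explicit so that subgraphs can be spoken of. *)
Definition hypergraph (V : finType) := ({set V} * {set {set V}})%type.

Definition is_hypergraph (V : finType) (G : hypergraph V) : bool :=
  G.2 \subset powerset G.1.

Definition subhypergraph (V : finType) (G' G : hypergraph V) : bool :=
  [&& is_hypergraph G', G'.1 \subset G.1 & G'.2 \subset G.2].

Definition shadow (V : finType) (E : {set {set V}}) : rel V :=
  [rel x y | (x != y) && [exists e in E, [set x; y] \subset e]].

(* For G satisfying is_hypergraph, shadow edges join vertices of G.1 only, so
   the paths witnessing connect stay inside G.1. *)
Definition hconnected (V : finType) (G : hypergraph V) : bool :=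
  (G.1 != set0) &&
  [forall x in G.1, forall y in G.1, connect (shadow G.2) x y].

Definition is_component (V : finType) (G C : hypergraph V) : bool :=
  [&& subhypergraph C G, hconnected C &
      [forall D : hypergraph V,
         [&& subhypergraph D G, hconnected D & subhypergraph C D] ==> (D == C)]].

Definition is_coloring (V : finType) (r : nat) (H : {set {set V}})
    (E : {ffun 'I_r -> {set {set V}}}) : bool :=
  (\bigcup_(i < r) E i == H) &&
  [forall i, forall j, (i != j) ==> [disjoint E i & E j]].

Definition mono_component (V : finType) (r : nat)
    (E : {ffun 'I_r -> {set {set V}}}) (C : hypergraph V) : bool :=
  [exists i, is_component ([set: V], E i) C].

Definition mc_bound (V : finType) (r : nat) (H : {set {set V}}) (m : nat) : bool :=
  [forall E : {ffun 'I_r -> {set {set V}}}, is_coloring H E ==>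
     [exists C : hypergraph V, mono_component E C && (m <= #|C.1|)]].

(* No component has more than #|V| vertices, so the range m <= #|V| loses
   nothing; see mc_attained and mc_max. *)
Definition mc (V : finType) (r : nat) (H : {set {set V}}) : nat :=
  \max_(m < #|V|.+1 | mc_bound r H m) m.

Definition alpha3_witness (V : finType) (H : {set {set V}}) (a : nat) : bool :=
  [exists X : {ffun 'I_3 -> {set V}},
     [&& [forall i, forall j, (i != j) ==> [disjoint X i & X j]],
         [forall i, #|X i| == a] &
         [forall e in H, exists i, e :&: X i == set0]]].

Definition alpha3star (V : finType) (H : {set {set V}}) : nat :=
  \max_(a < #|V|.+1 | alpha3_witness H a) a.

Definition steiner_triple_system (V : finType) (S : {set {set V}}) : Prop :=
  (forall e, e \in S -> #|e| = 3) /\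
  (forall x y : V, x != y -> exists! e, e \in S /\ [set x; y] \subset e).

Lemma component_exists (V : finType) (E : {set {set V}}) (x : V) :
  exists C, is_component ([set: V], E) C.
Proof.
pose P (C : hypergraph V) := subhypergraph C ([set: V], E) && hconnected C.
have P0 : P ([set x], set0).
  apply/andP; split; first by apply/and3P; split; rewrite ?subsetT // /is_hypergraph sub0set.
  apply/andP; split; first by apply/set0Pn; exists x; rewrite set11.
  by apply/forall_inP=> y /set1P->; apply/forall_inP=> z /set1P->; exact: connect0.
case: (arg_maxnP (fun C : hypergraph V => #|C.1| + #|C.2|) P0) => C /andP[sC cC] maxC.
exists C; apply/and3P; split=> //; apply/forallP=> D.
apply/implyP=> /and3P[sD cD /and3P[_ s1 s2]].
have := maxC D; rewrite /P sD cD => /(_ isT) leDC.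
have le1 := subset_leq_card s1; have le2 := subset_leq_card s2.
have e1 : C.1 = D.1.
  by apply/eqP; rewrite eqEcard s1 -(leq_add2r #|C.2|) (leq_trans _ leDC) ?leq_add2l.
have e2 : C.2 = D.2.
  by apply/eqP; rewrite eqEcard s2 -(leq_add2l #|C.1|) (leq_trans _ leDC) ?leq_add2r.
by case: C D e1 e2 {P0 sC cC maxC sD cD s1 s2 leDC le1 le2} => ? ? [? ?] /= -> ->.
Qed.

Lemma mc_attained (V : finType) (r : nat) (H : {set {set V}}) :
  0 < #|V| -> 0 < r -> mc_bound r H (mc r H).
Proof.
move=> /card_gt0P[x _] r0; rewrite /mc.
have b0 : mc_bound r H (@ord0 #|V|).
  apply/forallP=> E; apply/implyP=> _.
  have [C hC] := component_exists (E (Ordinal r0)) x.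
  by apply/existsP; exists C; rewrite andbT; apply/existsP; exists (Ordinal r0).
by rewrite (bigmax_eq_arg ord0) //; case: arg_maxnP.
Qed.

Lemma mc_max (V : finType) (r : nat) (H : {set {set V}}) (m : nat) :
  0 < r -> mc_bound r H m -> m <= mc r H.
Proof.
move=> r0 bm; suff lem : m < #|V|.+1.
  exact: (@leq_bigmax_cond _ (fun i : 'I_#|V|.+1 => mc_bound r H i)
            (fun i => i) (Ordinal lem)).
pose E : {ffun 'I_r -> {set {set V}}} :=
  [ffun i => if i == Ordinal r0 then H else set0].
have cE : is_coloring H E.
  apply/andP; split.
    rewrite (bigD1 (Ordinal r0)) //= ffunE eqxx big1 ?setU0 // => i /negPf ni.
    by rewrite ffunE ni.
  apply/forallP=> i; apply/forallP=> j; apply/implyP=> nij; rewrite !ffunE -setI_eq0.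
  case: (i =P Ordinal r0) nij => [->|_ _]; last by rewrite set0I.
  by rewrite eq_sym => /negPf->; rewrite setI0.
have /existsP[C /andP[_ mC]] := implyP (forallP bm E) cE.
by rewrite ltnS (leq_trans mC) ?max_card.
Qed.

Lemma alpha3star_attained (V : finType) (H : {set {set V}}) :
  alpha3_witness H (alpha3star H).
Proof.
rewrite /alpha3star.
have b0 : alpha3_witness H (@ord0 #|V|).
  apply/existsP; exists [ffun=> set0]; apply/and3P; split.
  - apply/forallP=> i; apply/forallP=> j; apply/implyP=> _.
    by rewrite !ffunE -setI_eq0 setI0.
  - by apply/forallP=> i; rewrite ffunE cards0.
  - by apply/forall_inP=> e _; apply/existsP; exists ord0; rewrite ffunE setI0.
by rewrite (bigmax_eq_arg ord0) //; case: arg_maxnP.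
Qed.

Lemma alpha3star_max (V : finType) (H : {set {set V}}) (a : nat) :
  alpha3_witness H a -> a <= alpha3star H.
Proof.
move=> wa; suff lea : a < #|V|.+1.
  exact: (@leq_bigmax_cond _ (fun i : 'I_#|V|.+1 => alpha3_witness H i)
            (fun i => i) (Ordinal lea)).
have /existsP[X /and3P[_ /forallP/(_ ord0)/eqP<- _]] := wa.
by rewrite ltnS max_card.
Qed.

(* Main.v *)
Require Import Defs.
From mathcomp Require Import all_boot.
From mathcomp Require Import zify.

Set Implicit Arguments.
Unset Strict Implicit.
Unset Printing Implicit Defensive.

(** Each color class induces an equivalence relation on the vertices (being in
    the same monochromatic component), and every pair of vertices is related
    by at least one of the three.  Let [A] be a largest class, say of [P], and
    [U] its complement.  If [U] lies in one class [B] of [Q] and one class [C]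
    of [R], then [U], [~: B], [~: C] are crossed by no edge, and the last two
    are at least as large as [U] by maximality of [A].  Otherwise [U] splits
    as [B1], [B2] and [A] as [A1], [A2], where [A1 :|: B1] and [A2 :|: B2] are
    classes of [Q], while [A2 :|: B1] and [A1 :|: B2] are classes of [R]; by
    maximality each [Ai] is at least as large as each [Bj], so the larger [Bj]
    together with [A1] and [A2] works. *)

(** * Triples of sets crossed by no class *)

Lemma subset_of_card (T : finType) (A : {set T}) (k : nat) :
  k <= #|A| -> exists2 B : {set T}, B \subset A & #|B| = k.
Proof.
move=> kA; exists [set x in take k (enum A)].
  by apply/subsetP=> x; rewrite inE => /mem_take; rewrite mem_enum.
rewrite cardsE; have /card_uniqP-> := take_uniq k (enum_uniq A).
by rewrite size_take -cardE; case: ltngtP kA.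
Qed.

(** For equivalence relations this says that no class meets all of [X], [Y] and [Z], since a class
    meeting [X] can be tested from its point there. *)
Definition uncrossed (V : finType) (P Q R : rel V) (X Y Z : {set V}) : Prop :=
  forall x y z, x \in X -> y \in Y -> z \in Z ->
  [/\ ~~ (P x y && P x z), ~~ (Q x y && Q x z) & ~~ (R x y && R x z)].

Definition large_uncrossed (V : finType) (P Q R : rel V) (k : nat) : Prop :=
  exists X Y Z : {set V},
    [/\ [&& [disjoint X & Y], [disjoint X & Z] & [disjoint Y & Z]],
        [&& k <= #|X|, k <= #|Y| & k <= #|Z|] & uncrossed P Q R X Y Z].

Lemma large_uncrossedC (V : finType) (P Q R : rel V) (k : nat) :
  large_uncrossed P Q R k -> large_uncrossed P R Q k.
Proof.
move=> [X [Y [Z [dis siz cr]]]]; exists X, Y, Z; split=> // x y z xX yY zZ.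
by have [] := cr x y z xX yY zZ.
Qed.

Lemma large_uncrossed_leq (V : finType) (P Q R : rel V) (k l : nat) :
  l <= k -> large_uncrossed P Q R k -> large_uncrossed P Q R l.
Proof.
move=> lk [X [Y [Z [dis /and3P[kX kY kZ] cr]]]]; exists X, Y, Z; split=> //.
by rewrite !(leq_trans lk).
Qed.

Lemma equivalence_rel_sym (T : Type) (r : rel T) :
  equivalence_rel r -> symmetric r.
Proof.
move=> e; suff sub x y : r x y -> r y x by move=> x y; apply/idP/idP; exact: sub.
by move=> rxy; have [_ <-] := e x y x; have [] := e x x x.
Qed.

Lemma equivalence_rel_trans (T : Type) (r : rel T) :
  equivalence_rel r -> transitive r.
Proof. by move=> e y x z rxy; have [_ ->] := e x y z. Qed.

(** * Three equivalence relations that together relate all pairs *)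

Section ThreeEquivalences.

Variables (V : finType) (P Q R : rel V) (p : V).
Hypotheses (Pe : equivalence_rel P) (Qe : equivalence_rel Q)
  (Re : equivalence_rel R).
Hypothesis cov : forall x y, [|| P x y, Q x y | R x y].
Hypothesis Qmax : forall x, #|[set y | Q x y]| <= #|[set y | P p y]|.
Hypothesis Rmax : forall x, #|[set y | R x y]| <= #|[set y | P p y]|.

Let A := [set y | P p y].

Let Psym := equivalence_rel_sym Pe.
Let Qsym := equivalence_rel_sym Qe.
Let Rsym := equivalence_rel_sym Re.
Let Ptr := equivalence_rel_trans Pe.
Let Qtr := equivalence_rel_trans Qe.
Let Rtr := equivalence_rel_trans Re.

Let AP x y : x \in ~: A -> y \in A -> ~~ P x y.
Proof.
rewrite !inE => nx py; apply: contra nx => xy.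
by apply: Ptr py _; rewrite Psym.
Qed.

Let QR x y : x \in ~: A -> y \in A -> Q x y || R x y.
Proof. by move=> xU yA; have := cov x y; rewrite (negPf (AP xU yA)). Qed.

(** By maximality, a [Q]-class containing [A] would equal [A] and could not contain a point outside
    [A]. *)
Let Qnsub x : x \in ~: A -> ~~ (A \subset [set y | Q x y]).
Proof.
rewrite in_setC => xA; apply: contra xA => sA.
suff -> : A = [set y | Q x y] by rewrite inE; have [] := Qe x x x.
by apply/eqP; rewrite eqEcard sA Qmax.
Qed.

Let Rnsub x : x \in ~: A -> ~~ (A \subset [set y | R x y]).
Proof.
rewrite in_setC => xA; apply: contra xA => sA.
suff -> : A = [set y | R x y] by rewrite inE; have [] := Re x x x.
by apply/eqP; rewrite eqEcard sA Rmax.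
Qed.

(** Both classes of [u] contain [~: A], so their complements lie in [A]; these are disjoint because
    [cov] relates [u] to each point of [A] by [Q] or [R]. A point of [~: A] shares the [Q]-class and
    the [R]-class of [u], each of which misses one of the complements. *)
Lemma large_uncrossed_common (u : V) :
  u \in ~: A -> {in ~: A, forall v, Q u v} -> {in ~: A, forall v, R u v} ->
  large_uncrossed P Q R #|~: A|.
Proof.
move=> uU Qu Ru; exists (~: A), (~: [set y | R u y]), (~: [set y | Q u y]).
have inA y : ~~ Q u y || ~~ R u y -> y \in A.
  by apply: contraLR; rewrite -in_setC => yU; rewrite Qu // Ru.
have cA := cardsC A.
split.
- rewrite !disjoints_subset setCK.
  apply/and3P; split; apply/subsetP=> y; rewrite !(in_setC, in_set (Q u), in_set (R u)).
  + by move=> yU; rewrite Ru // in_setC.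
  + by move=> yU; rewrite Qu // in_setC.
  + move=> nR; have yA : y \in A by rewrite inA // nR orbT.
    by have := QR uU yA; rewrite (negPf nR) orbF negbK.
- rewrite leqnn.
  have := cardsC [set y | R u y]; have := cardsC [set y | Q u y].
  by have := Rmax u; have := Qmax u; rewrite -/A; lia.
move=> x y z xU; rewrite !in_setC (in_set (R u)) (in_set (Q u)) => nR nQ; split.
- by rewrite negb_and AP // inA // nR orbT.
- apply/negP=> /andP[_ xz]; case/negP: nQ.
  exact: Qtr (Qu _ xU) xz.
- apply/negP=> /andP[xy _]; case/negP: nR.
  exact: Rtr (Ru _ xU) xy.
Qed.

Let disj (r : rel V) (re : equivalence_rel r) u v y :
  ~~ r u v -> r u y -> ~~ r v y.
Proof.
move=> nuv uy; apply: contra nuv; rewrite (equivalence_rel_sym re).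
exact: equivalence_rel_trans uy.
Qed.

Lemma large_uncrossed_block (u v : V) :
  u \in ~: A -> v \in ~: A -> ~~ Q u v -> ~~ R u v ->
  large_uncrossed P Q R #|[set w in ~: A | Q u w && R u w]|.
Proof.
move=> uU vU nQ nR; set B := [set w in _ | _].
pose A1 := [set y in A | Q u y && R v y].
pose A2 := [set y in A | R u y && Q v y].
(* Each [y] in [A] is related to both [u] and [v] by [Q] or [R], but never to both by the same
   relation, as their classes differ. *)
have cA : #|A| <= #|A1| + #|A2|.
  apply: leq_trans (leq_card_setU A1 A2); apply/subset_leq_card/subsetP=> y yA.
  rewrite in_setU !(in_set (fun y => _ && _)) yA /=.
  have := QR uU yA; have := QR vU yA.
  case: (boolP (Q u y)) => [/(disj Qe nQ)/negPf->/= -> //|_ /=].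
  by case: (boolP (R u y)) => // /(disj Re nR)/negPf->; rewrite orbF.
have dA D : [disjoint B & [set y in A | D y]].
  rewrite -setI_eq0; apply/eqP/setP=> y; rewrite !inE.
  by case: (P p y); rewrite ?andbF.
have d12 : [disjoint A1 & A2].
  rewrite -setI_eq0; apply/eqP/setP=> y; rewrite !inE; apply/negP.
  by case/and3P=> /and3P[_ /(disj Qe nQ)/negPf-> _] _; rewrite andbF.
(* [B] and [A1] share the [Q]-class of [u], so [cA] yields [#|B| <= #|A2|]; [le2] likewise yields
   [#|B| <= #|A1|]. *)
have le1 : #|B| + #|A1| <= #|A|.
  apply: leq_trans (Qmax u); have := dA (fun y => Q u y && R v y).
  rewrite -(leq_card_setU _ _).2 => /eqP<-; apply/subset_leq_card/subsetP=> y.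
  by rewrite !inE => /orP[] /and3P[].
have le2 : #|B| + #|A2| <= #|A|.
  apply: leq_trans (Rmax u); have := dA (fun y => R u y && Q v y).
  rewrite -(leq_card_setU _ _).2 => /eqP<-; apply/subset_leq_card/subsetP=> y.
  by rewrite !inE => /orP[] /and3P[].
exists B, A1, A2; split; [by rewrite !dA | by apply/and3P; split; lia |].
move=> x y z; rewrite !(in_set (fun y => _ && _)).
case/and3P=> xU ux ux' /and3P[yA _ vy] /and3P[_ _ vz]; split.
- by rewrite negb_and AP.
- apply/negP=> /andP[_ xz]; case/negP: (disj Qe nQ (Qtr ux xz)).
  exact: vz.
- apply/negP=> /andP[xy _]; case/negP: (disj Re nR (Rtr ux' xy)).
  exact: vy.
Qed.

Lemma large_uncrossed_split (u v : V) :
  u \in ~: A -> v \in ~: A -> ~~ Q u v ->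
  large_uncrossed P Q R (uphalf #|~: A|).
Proof.
move=> uU vU nQ.
(* If [R u v] held, any [y] in [A] with [Q u y] would fail [Q v y], hence satisfy [R v y] and then
   [R u y]: the [R]-class of [u] would contain [A]. *)
have nR : ~~ R u v.
  apply: contra (Rnsub uU) => uv; apply/subsetP=> y yA; rewrite inE.
  case/orP: (QR uU yA) => // /(disj Qe nQ)/negPf nvy.
  by have := QR vU yA; rewrite nvy /=; exact: Rtr.
(* [a1] and [a2] represent the two parts [A1] and [A2] of [A]. *)
have [a1 a1A] := subsetPn (Rnsub uU); rewrite inE => nua1.
have [a2 a2A] := subsetPn (Qnsub uU); rewrite inE => nua2.
have ua1 : Q u a1 by have := QR uU a1A; rewrite (negPf nua1) orbF.
have ua2 : R u a2 by have := QR uU a2A; rewrite (negPf nua2).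
have va1 : R v a1 by have := QR vU a1A; rewrite (negPf (disj Qe nQ ua1)).
have va2 : Q v a2 by have := QR vU a2A; rewrite (negPf (disj Re nR ua2)) orbF.
pose B u := [set w in ~: A | Q u w && R u w].
(* If [w] were linked to [a1] and [a2] by the same relation, [u] and [v] would share a class of it;
   mixed links place [w] in [B u] or [B v]. *)
have cU : #|~: A| <= #|B u| + #|B v|.
  apply: leq_trans (leq_card_setU _ _); apply/subset_leq_card/subsetP=> w wU.
  rewrite in_setU !(in_set (fun y => _ && _)) wU /=.
  case/orP: (QR wU a1A); rewrite (Qsym, Rsym) => wa1;
  case/orP: (QR wU a2A); rewrite (Qsym, Rsym) => wa2.
  - by have := disj Qe nQ (Qtr ua1 wa1); rewrite (Qtr va2 wa2).
  - by rewrite (Qtr ua1 wa1) (Rtr ua2 wa2).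
  - by rewrite (Qtr va2 wa2) (Rtr va1 wa1) orbT.
  - by have := disj Re nR (Rtr ua2 wa2); rewrite (Rtr va1 wa1).
case: (leqP #|B v| #|B u|) => le.
- by apply: large_uncrossed_leq (large_uncrossed_block uU vU nQ nR);
  rewrite leq_uphalf_double -/(B u); lia.
- rewrite Qsym in nQ; rewrite Rsym in nR.
  by apply: large_uncrossed_leq (large_uncrossed_block vU uU nQ nR);
  rewrite leq_uphalf_double -/(B v); lia.
Qed.

End ThreeEquivalences.

Lemma large_uncrossed_exists (V : finType) (P Q R : rel V) (p : V) :
  equivalence_rel P -> equivalence_rel Q -> equivalence_rel R ->
  (forall x y, [|| P x y, Q x y | R x y]) ->
  (forall x, #|[set y | Q x y]| <= #|[set y | P p y]|) ->
  (forall x, #|[set y | R x y]| <= #|[set y | P p y]|) ->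
  large_uncrossed P Q R (uphalf #|~: [set y | P p y]|).
Proof.
move=> Pe Qe Re cov Qm Rm; set U := ~: _.
have [U0|[u uU]] := set_0Vmem U.
  exists set0, set0, set0; rewrite U0 !cards0 -!setI_eq0 !setI0 eqxx.
  by split=> // x y z; rewrite inE.
have [/forall_inP Qu|] := boolP [forall v in U, Q u v]; last first.
  by case/forall_inPn=> v vU; exact: large_uncrossed_split.
have [/forall_inP Ru|] := boolP [forall v in U, R u v]; last first.
  (* The situation is symmetric in [Q] and [R], so the split applies with the two exchanged. *)
  case/forall_inPn=> v vU nR; apply: large_uncrossedC.
  apply: (large_uncrossed_split Pe Re Qe _ _ _ uU vU nR) => // x y.
  by rewrite [R x y || _]orbC.
by apply: large_uncrossed_leq (large_uncrossed_common _ _ _ _ _ _ uU Qu Ru);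
  rewrite // leq_uphalf_double -addnn leq_addr.
Qed.

(** * Components as classes of shadow connectivity *)

Lemma shadow_sym (V : finType) (E : {set {set V}}) : symmetric (shadow E).
Proof. by move=> x y; rewrite /shadow /= eq_sym setUC. Qed.

Lemma shadow_subset (V : finType) (E F : {set {set V}}) :
  E \subset F -> subrel (shadow E) (shadow F).
Proof.
move=> /subsetP EF x y /andP[xy /exists_inP[e eE xye]].
by rewrite /shadow /= xy; apply/exists_inP; exists e; rewrite ?EF.
Qed.

Lemma connect_shadow_edge (V : finType) (E : {set {set V}}) (e : {set V}) x y :
  e \in E -> x \in e -> y \in e -> connect (shadow E) x y.
Proof.
move=> eE xe ye; have [->|nxy] := eqVneq x y; first exact: connect0.
apply: connect1; rewrite /shadow /= nxy; apply/exists_inP; exists e => //.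
by rewrite subUset !sub1set xe.
Qed.

Lemma connect_shadow_equiv (V : finType) (E : {set {set V}}) :
  equivalence_rel (connect (shadow E)).
Proof.
move=> x y z; split=> // xy; have sym := sym_connect_sym (@shadow_sym V E).
exact: (same_connect sym xy).
Qed.

Lemma class_is_component (V : finType) (E : {set {set V}}) (x : V)
    (K := [set y | connect (shadow E) x y]) :
  is_component ([set: V], E) (K, [set e in E | e \subset K]).
Proof.
set F := [set e in E | _].
have FE : F \subset E by apply/subsetP=> e; rewrite inE => /andP[].
have sym G := sym_connect_sym (@shadow_sym V G).
have EF : {in K, forall y, connect (shadow F) x y}.
  (* A path leaving [x] never needs an edge outside [F]: an edge with one vertex reachable from [x]
     lies entirely in [K]. *)
  have cl : closed (shadow E) (connect (shadow F) x).
    apply: intro_closed; first exact: sym.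
    move=> y z yz xy; apply: connect_trans (xy) _.
    have /andP[_ /exists_inP[e eE]] := yz.
    rewrite subUset !sub1set => /andP[ye ze].
    apply: (@connect_shadow_edge _ _ e) => //; rewrite inE eE /=.
    apply/subsetP=> w we; rewrite inE.
    apply: connect_trans (connect_sub _ xy) (connect_shadow_edge eE ye we).
    by move=> a b /(shadow_subset FE)/connect1.
  by move=> y; rewrite inE => /(closed_connect cl); rewrite !inE connect0.
apply/and3P; split.
- rewrite /subhypergraph /is_hypergraph subsetT FE /= andbT.
  by apply/subsetP=> e; rewrite !inE => /andP[].
- apply/andP; split; first by apply/set0Pn; exists x; rewrite inE connect0.
  apply/forall_inP=> y yK; apply/forall_inP=> z zK.
  by apply: connect_trans (EF z zK); rewrite sym EF.
apply/forallP=> -[D G]; apply/implyP=> /and3P[/and3P[hD _ GE] /andP[_ cD]].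
case/and3P=> _ /= KD FG.
have DK : D \subset K.
  apply/subsetP=> y yD; rewrite inE.
  have xD : x \in D by apply: (subsetP KD); rewrite inE connect0.
  apply: connect_sub (forall_inP (forall_inP cD x xD) y yD).
  by move=> a b /(shadow_subset GE)/connect1.
rewrite xpair_eqE !eqEsubset DK KD /=; apply/andP; split=> //.
apply/subsetP=> e eG.
rewrite inE (subsetP GE) //= (subset_trans _ DK) //.
by have := subsetP hD e eG; rewrite inE.
Qed.

(** * From equivalence classes back to colorings *)

Theorem theorem1p3 (V : finType) (S : {set {set V}}) (n : nat) :
  steiner_triple_system S -> #|V| = n ->
  mc 3 S >= n - 2 * alpha3star S.
Proof.
move=> [_ pairs] <-; have [V0|[x0 _]] := set_0Vmem [set: V].
  by rewrite -cardsT V0 cards0.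
apply: mc_max => //; apply/forallP=> E; apply/implyP=> /andP[/eqP colE _].
pose r i := connect (shadow (E i)).
have re i : equivalence_rel (r i) by exact: connect_shadow_equiv.
(* Maximizing over color and vertex jointly bounds the classes of the other two colors as well. *)
pose f (ix : 'I_3 * V) := #|[set y | r ix.1 ix.2 y]|.
have [[i p] _ max] := @arg_maxnP _ (ord0, x0) xpredT f isT.
set A := [set y | r i p y].
apply/existsP; exists (A, [set e in E i | e \subset A]); apply/andP; split.
  by apply/existsP; exists i; exact: class_is_component.
(* The other two colors are the cyclic successors of [i]. *)
have [j [k ijk]] : exists j k, forall l : 'I_3, [|| l == i, l == j | l == k].
  exists (ordS i), (ordS (ordS i)) => l.
  by case: i l {max A} => [[|[|[|?]]]] // ? [[|[|[|?]]]].
have cov x y : [|| r i x y, r j x y | r k x y].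
  have [->|nxy] := eqVneq x y; first by rewrite /r connect0.
  have [e [[eS]]] := pairs x y nxy; rewrite subUset !sub1set => /andP[xe ye] _.
  move: eS; rewrite -colE => /bigcupP[l _ eE].
  have := connect_shadow_edge eE xe ye; rewrite -/(r l x y).
  by have /or3P[/eqP->|/eqP->|/eqP->] := ijk l => ->; rewrite ?orbT.
have [X [Y [Z [dis siz cr]]]] := large_uncrossed_exists (re i) (re j) (re k)
  cov (fun x => max (j, x) isT) (fun x => max (k, x) isT).
(* This suffices because [#|V| - #|A|] is [#|~: A|], at most twice its upper half. *)
have : uphalf #|~: A| <= alpha3star S; last first.
  by rewrite leq_uphalf_double -muln2 leq_subLR -(cardsC A) /=; lia.
apply: alpha3star_max; set a := uphalf _ in siz *.
(* The witness sets must have equal size, so all three are trimmed to exactly [a] elements. *)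
case/and3P: siz => /subset_of_card[X' sX cX] /subset_of_card[Y' sY cY].
move=> /subset_of_card[Z' sZ cZ].
have [dXY dXZ dYZ] := and3P dis.
have {}dis (X1 Y1 X2 Y2 : {set V}) :
  [disjoint X1 & Y1] -> X2 \subset X1 -> Y2 \subset Y1 ->
  [disjoint X2 & Y2] /\ [disjoint Y2 & X2].
  move=> d1 s1 s2; rewrite (disjoint_sym Y2); split; exact: disjointW d1.
have [xy yx] := dis _ _ _ _ dXY sX sY; have [xz zx] := dis _ _ _ _ dXZ sX sZ.
have [yz zy] := dis _ _ _ _ dYZ sY sZ.
pose W := [ffun m : 'I_3 => tnth [tuple X'; Y'; Z'] m].
apply/existsP; exists W; apply/and3P; split.
- apply/forallP=> -[[|[|[|?]]] // ?]; apply/forallP=> -[[|[|[|?]]] // ?];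
    by rewrite !ffunE; apply/implyP.
- by apply/forallP=> -[[|[|[|?]]] // ?]; rewrite ffunE; apply/eqP.
(* An edge meeting all three sets would put a point of each into one class of its color,
   contradicting [cr]. *)
apply/forall_inP=> e eS; apply: contraT => /existsPn hit.
have [x /setIP[xe /(subsetP sX) xX]] : exists x, x \in e :&: X'.
  by apply/set0Pn; have := hit ord0; rewrite ffunE.
have [y /setIP[ye /(subsetP sY) yY]] : exists y, y \in e :&: Y'.
  by apply/set0Pn; have := hit (inord 1); rewrite ffunE (tnth_nth X') inordK.
have [z /setIP[ze /(subsetP sZ) zZ]] : exists z, z \in e :&: Z'.
  by apply/set0Pn; have := hit (inord 2); rewrite ffunE (tnth_nth X') inordK.
have [nP nQ nR] := cr x y z xX yY zZ.
move: eS; rewrite -colE => /bigcupP[l _ eE].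
have rxy : r l x y := connect_shadow_edge eE xe ye.
have rxz : r l x z := connect_shadow_edge eE xe ze.
have := rxz; have := rxy.
by have /or3P[/eqP->|/eqP->|/eqP->] := ijk l => h1 h2;
  move: nP nQ nR; rewrite h1 h2 ?andbF.
Qed.
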